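(* Let $\mathcal{X}$ be a smooth manifold with a closed reflexive relation $\le$. Let $X=A\cup B\cup\{1\}$ be a finite set, where $A$, $B$ and $\{1\}$ are pairwise disjoint and $A\neq\emptyset$, $B\neq\emptyset$. Let $t$, $t^{1}$, $t^{2}$ be linear systems of generalized time-ordered functions (GTOF) in variables indexed by $X$, $A\cup\{1\}$ and $B\cup\{1\}$ respectively, and suppose that for every proper sequence $\{J_1,\dots,J_\nu\}$ in $\mathcal{P}(X)$ $$t_{J_1,\dots,J_\nu}(\{x\}_X)=t^{1}_{J_1\cap(A\cup\{1\}),\dots,J_\nu\cap(A\cup\{1\})}(\{x\}_{A\cup\{1\}})\ t^{2}_{J_1\cap(B\cup\{1\}),\dots,J_\nu\cap(B\cup\{1\})}(\{x\}_{B\cup\{1\}}),$$ where empty sets are omitted from the sequences of indices on the right-hand side. Then for every cell $\mathcal{S}$ relative to $X$, with opposite cell $\mathcal{S}'$, the associated generalized retarded functions factorize: $$r_{\mathcal{S}}=r_{\mathcal{S}_A}\,r_{\mathcal{S}_B},$$ where $r_{\mathcal{S}}$, $r_{\mathcal{S}_A}$, $r_{\mathcal{S}_B}$ are built from $t$, $t^1$, $t^2$ respectively, and the cells $\mathcal{S}_A$ (relative to $A\cup\{1\}$) and $\mathcal{S}_B$ (relative to $B\cup\{1\}$) are those induced by $\mathcal{S}$, as defined in the context.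
   Context: Sets and cells. For a finite set $W$ with $|W|\ge2$, $\mathcal{P}_*(W)$ is the set of subsets of $W$ different from $\emptyset$ and $W$. A proper sequence in $\mathcal{P}(W)$ is a finite (ordered) sequence $\{J_1,\dots,J_\nu\}$ of non-empty, pairwise disjoint subsets of $W$ with union $W$. A paracell relative to $W$ is a non-empty $\mathcal{S}\subset\mathcal{P}_*(W)$ such that $I,J\in\mathcal{S}$ implies $I\cap J\in\mathcal{S}$ or $I\cup J\in\mathcal{S}$; its opposite is $\mathcal{S}'=\{J\subset W: W\setminus J\in\mathcal{S}\}$. A precell is a paracell with $\mathcal{S}\cup\mathcal{S}'=\mathcal{P}_*(W)$. A cell is a precell $\mathcal{S}$ for which there exist real numbers $(s_j)_{j\in W}$ with $\sum_{j\in W}s_j=0$ and $\sum_{j\in J}s_j>0$ for all $J\in\mathcal{S}$; then $\mathcal{S}'$ is also a cell. Induced cells. For opposite cells $\mathcal{S},\mathcal{S}'$ relative to $X=A\cup B\cup\{1\}$, $$\mathcal{S}_A=\{J\in\mathcal{P}_*(A\cup\{1\}): J\subset A,\ J\in\mathcal{S}\}\cup\{J\in\mathcal{P}_*(A\cup\{1\}): 1\in J,\ A\setminus J\in\mathcal{S}'\},$$ and $\mathcal{S}_B$ is defined in the same way with $B$ in place of $A$. (These are cells relative to $A\cup\{1\}$ and $B\cup\{1\}$.) GTOF. Write $\mathcal{X}^W$ for the set of maps $W\to\mathcal{X}$ and $\{x\}_K=\{x_j: j\in K\}$. A linear system of GTOF in variables indexed by $W$ is a family of distributions $t_{J_1,\dots,J_\nu}$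 on $\mathcal{X}^W$, indexed by the proper sequences in $\mathcal{P}(W)$ (so that each distribution depends on each $J_k$ only as an unordered set of labelled variables), such that: (PR, partial regularity) for every $k\in W$, each $t_{J_1,\dots,J_\nu}$ is $C^\infty$ in the variable $x_k$ when smeared with smooth test functions in the remaining variables; (causal factorization) whenever $W=P\cup R$ with $P\cap R=\emptyset$, the distribution $t_{J_1,\dots,J_\nu}-t_{J_1\cap P,\,J_1\cap R,\dots,J_\nu\cap P,\,J_\nu\cap R}$ (empty sets omitted) vanishes in the open set of all $x\in\mathcal{X}^W$ such that for all $j\in P$, $k\in R$, $x_j\le x_k$ does not hold. Products. A product $F_1(\{x\}_{A\cup\{1\}})F_2(\{x\}_{B\cup\{1\}})$ of distributions having property PR is defined as follows: smearing with test functions in the variables indexed by $A$ and by $B$ yields the product of two $C^\infty$ functions of $x_1$, which is then integrated against a test function of $x_1$ (functions being identified with distributions by a fixed smooth positive density on $\mathcal{X}$). Generalized retarded functions. Given a linear system $t$ of GTOF indexed by $W$ and a cell $\mathcal{S}$ relative to $W$ with opposite cell $\mathcal{S}'$, $$r_{\mathcal{S}}=\sum_{\nu=1}^{|W|}(-1)^{\nu-1}\sum_{\{J_1,\dots,J_\nu\}\in\mathcal{M}_\nu(\mathcal{S}')}t_{J_1,\dots,J_\nu},$$ where $\mathcal{M}_\nu(\mathcal{S}')$ is the set of proper sequences $\{J_1,\dots,J_\nu\}$ in $\mathcal{P}(W)$ with $J_1\cup\dots\cup J_r\in\mathcal{S}'$ for every $1\le r<\nu$ (no condition if $\nu=1$).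 *)

(* Defs.v *)
From HB Require Import structures.
From mathcomp Require Import all_boot all_order all_algebra.
From mathcomp Require Import complex.

Set Implicit Arguments.
Unset Strict Implicit.
Unset Printing Implicit Defensive.
Import Order.TTheory GRing.Theory Num.Theory.
Local Open Scope ring_scope.

(* The combinatorial part comes before the imports of mathcomp-analysis, so
   that the set notations below are those of finset. *)

Section Cells.
Context {W : finType}.
Implicit Types (S : {set {set W}}) (s : seq {set W}) (P Q : {set W}).

Definition Pstar : {set {set W}} := [set J | (J != set0) && (J != setT)].

Definition proper_sequence s : bool :=
  [&& set0 \notin s, pairwise (fun I J : {set W} => [disjoint I & J]) s
    & \bigcup_(J <- s) J == setT].

Definition paracell S : Prop :=
  [/\ S != set0, S \subset Pstar
    & forall I J, I \in S -> J \in S -> (I :&: J \in S) \/ (I :|: J \in S)].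

Definition opposite S : {set {set W}} := [set J | ~: J \in S].

Definition precell S : Prop := paracell S /\ S :|: opposite S = Pstar.

Definition cell (R : realFieldType) S : Prop :=
  precell S /\
  exists c : W -> R,
    \sum_j c j = 0 /\ forall J, J \in S -> 0 < \sum_(j in J) c j.

Definition in_M S s : bool :=
  proper_sequence s &&
  [forall r : 'I_(size s), (0 < r)%N ==> (\bigcup_(J <- take r s) J \in S)].

Definition bipartition P Q : Prop := P :|: Q = setT /\ P :&: Q = set0.

Definition refine_seq P Q s : seq {set W} :=
  [seq J <- flatten [seq [:: J :&: P; J :&: Q] | J <- s] | J != set0].

End Cells.

(* An injection h : V -> W presents V as a subset of W; J :&: V is then the
   preimage of J. *)
Definition restrict_seq (V W : finType) (h : V -> W) (s : seq {set W}) :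
    seq {set V} :=
  [seq J <- [seq h @^-1: J | J : {set W} <- s] | J != set0].

(* S_A for h the inclusion of A u {1} (elements Some a and None) in W. *)
Definition induced_cell (A W : finType) (h : option A -> W)
    (S : {set {set W}}) : {set {set option A}} :=
  [set J in Pstar | (None \notin J) && (h @: J \in S)] :|:
  [set J in Pstar |
     (None \in J) && (h @: ([set~ None] :\: J) \in opposite S)].

(* Inclusions of A u {1} and B u {1} in the disjoint union A u B u {1}. *)
Definition inA (A B : finType) : option A -> option (A + B)%type := omap inl.
Definition inB (A B : finType) : option B -> option (A + B)%type := omap inr.
Arguments inA : clear implicits.
Arguments inB : clear implicits.

From mathcomp Require Import all_classical all_reals all_analysis.
Import numFieldNormedType.Exports.
Local Open Scope classical_set_scope.

Section Calculus.
Context {R : realType} {m n : nat}.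

Definition partial (p : 'I_m * 'I_n) (f : 'M[R]_(m, n) -> R) :
    'M[R]_(m, n) -> R :=
  fun u => 'D_(delta_mx p.1 p.2) f u.

Definition iter_partial (s : seq ('I_m * 'I_n)) (f : 'M[R]_(m, n) -> R) :=
  foldr partial f s.

(* C^oo on the open set U: all iterated partial derivatives exist and are
   continuous at the points of U. *)
Definition smooth_on (U : set 'M[R]_(m, n)) (f : 'M[R]_(m, n) -> R) : Prop :=
  forall s u, U u ->
    {for u, continuous (iter_partial s f)} /\
    forall p : 'I_m * 'I_n,
      derivable (iter_partial s f) u (delta_mx p.1 p.2).

End Calculus.

(* Iterated integral; by Tonelli it is the integral with respect to Lebesgue
   measure on R^n for nonnegative Borel functions. *)
Fixpoint lebesgue_int (R : realType) (n : nat) :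
    ('rV[R]_n -> \bar R) -> \bar R :=
  match n with
  | 0%N => fun f => f 0
  | k.+1 => fun f =>
      (\int[lebesgue_measure]_(x in [set: R])
         lebesgue_int (fun v : 'rV[R]_k =>
           f (row_mx (const_mx x : 'rV[R]_1) v)))%E
  end.

(* cto and cfrom are total functions; only their restrictions to cdom and cim
   matter. *)
Record chart (R : realType) (M : topologicalType) (n : nat) := Chart {
  cdom : set M;
  cim : set 'rV[R]_n;
  cto : M -> 'rV[R]_n;
  cfrom : 'rV[R]_n -> M;
  cdom_open : open cdom;
  cim_open : open cim;
  cto_im : forall x, cdom x -> cim (cto x);
  cfrom_dom : forall u, cim u -> cdom (cfrom u);
  ctoK : forall x, cdom x -> cfrom (cto x) = x;
  cfromK : forall u, cim u -> cto (cfrom u) = u;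
  cto_continuous : {within cdom, continuous cto};
  cfrom_continuous : {within cim, continuous cfrom} }.

(* The carrier is pointed (nonempty) because measurable types are. *)
Record manifold (R : realType) := Manifold {
  carrier :> ptopologicalType;
  dim : nat;
  atlas : set (chart R carrier dim);
  carrier_hausdorff : hausdorff_space carrier;
  carrier_second_countable : @second_countable carrier;
  atlas_cover : forall x : carrier, exists2 c, atlas c & cdom c x;
  atlas_smooth : forall c d, atlas c -> atlas d -> forall j : 'I_dim,
    smooth_on (cim c `&` cfrom c @^-1` cdom d)
      (fun u => cto d (cfrom c u) ord0 j) }.

Definition borel (T : ptopologicalType) := g_sigma_algebraType (@open T).

Section Distributions.
Context {R : realType} {M : manifold R}.
Local Notation C := (R[i]).
Local Notation Re := (@complex.Re R).
Local Notation Im := (@complex.Im R).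
Local Notation "M ^^ W" := ({ptws W -> carrier M}) (at level 30, only parsing).

Definition supp (T : topologicalType) (f : T -> C) : set T :=
  closure [set x | f x != 0].

Definition smooth (f : M -> C) : Prop :=
  forall c, atlas c ->
    smooth_on (cim c) (Re \o f \o cfrom c) /\
    smooth_on (cim c) (Im \o f \o cfrom c).

Definition test_fun (f : M -> C) : Prop := smooth f /\ compact (supp f).

Section Power.
Context {W : finType}.

(* A family of charts c of M gives a chart of the product manifold M^W with
   coordinates in the space of (#|W| x dim M)-matrices; the row of index
   enum_rank w holds the coordinates of the variable x_w. *)
Definition pcim (c : W -> chart R M (dim M)) : set 'M[R]_(#|W|, dim M) :=
  [set u | forall w, cim (c w) (row (enum_rank w) u)].

Definition pcfrom (c : W -> chart R M (dim M)) (u : 'M[R]_(#|W|, dim M)) :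
    M ^^ W :=
  fun w => cfrom (c w) (row (enum_rank w) u).

Definition psmooth (f : M ^^ W -> C) : Prop :=
  forall c, (forall w, atlas (c w)) ->
    smooth_on (pcim c) (Re \o f \o pcfrom c) /\
    smooth_on (pcim c) (Im \o f \o pcfrom c).

Definition ptest_fun (f : M ^^ W -> C) : Prop :=
  psmooth f /\ compact (supp f).

(* Convergence to 0 in the space of test functions: the supports lie in a
   common compact set, and every derivative in local coordinates converges to 0
   uniformly on compact sets. *)
Definition ptest_cvg0 (f : nat -> M ^^ W -> C) : Prop :=
  (exists2 K : set (M ^^ W), compact K & forall k, supp (f k) `<=` K) /\
  forall c, (forall w, atlas (c w)) ->
  forall L, compact L -> L `<=` pcim c ->
  forall s (e : R), 0 < e ->
  \forall k \near \oo, forall u, L u ->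
    `|iter_partial s (Re \o f k \o pcfrom c) u| < e /\
    `|iter_partial s (Im \o f k \o pcfrom c) u| < e.

(* A functional on the space of test functions is represented by a total
   function whose values outside ptest_fun are irrelevant. The space is a strict
   inductive limit of Frechet spaces, so sequential continuity is continuity. *)
Definition distribution (T : (M ^^ W -> C) -> C) : Prop :=
  (forall (a : C) f g, ptest_fun f -> ptest_fun g ->
     T (fun x => a * f x + g x) = a * T f + T g) /\
  (forall f : nat -> M ^^ W -> C, (forall k, ptest_fun (f k)) ->
     ptest_cvg0 f ->
     (fun k => Re (T (f k))) @ \oo --> (0 : R) /\
     (fun k => Im (T (f k))) @ \oo --> (0 : R)).

Definition vanishes_on (O : set (M ^^ W))
    (T : (M ^^ W -> C) -> C) : Prop :=
  forall f, ptest_fun f -> supp f `<=` O -> T f = 0.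

End Power.

Section Density.
Variable mu : {measure set (borel M) -> \bar R}.

(* A Radon measure which in every chart has a smooth positive density with
   respect to Lebesgue measure. *)
Definition smooth_positive_density : Prop :=
  (forall K : set M, compact K -> (mu K < +oo)%E) /\
  forall c : chart R M (dim M), atlas c ->
    exists rho : 'rV[R]_(dim M) -> R,
      [/\ smooth_on (cim c) rho, forall u, cim c u -> 0 < rho u &
        forall E : set (borel M), measurable E -> E `<=` cdom c ->
          mu E = lebesgue_int (fun u =>
            (\1_(cim c `&` cfrom c @^-1` E) u * rho u)%:E)].

Definition cintegral (f : M -> C) : C :=
  Complex (Rintegral mu setT (Re \o f)) (Rintegral mu setT (Im \o f)).

(* g is the C^oo function of x_k obtained by smearing F with phi in the
   remaining variables, which are listed by h : K -> W. *)
Definition smearing (K W : finType) (h : K -> W) (k : W)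
    (F : (M ^^ W -> C) -> C) (phi : M ^^ K -> C) (g : M -> C) : Prop :=
  smooth g /\
  forall psi, test_fun psi ->
    F (fun x => phi (x \o h) * psi (x k)) = cintegral (fun y => g y * psi y).

Definition partially_regular (W : finType) (F : (M ^^ W -> C) -> C) : Prop :=
  forall (k : W) (phi : M ^^ {j : W | j != k} -> C), ptest_fun phi ->
    exists g, smearing val k F phi g.

(* F = F1({x}_{A u {1}}) F2({x}_{B u {1}}): the values on phiA * phiB * psi
   determine F, since the linear span of these test functions is dense. *)
Definition is_product (A B : finType)
    (F : (M ^^ (option (A + B)%type) -> C) -> C)
    (F1 : (M ^^ (option A) -> C) -> C)
    (F2 : (M ^^ (option B) -> C) -> C) : Prop :=
  forall phiA phiB, ptest_fun phiA -> ptest_fun phiB ->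
  exists g1 g2 : M -> C,
    [/\ smearing Some None F1 phiA g1, smearing Some None F2 phiB g2 &
      forall psi, test_fun psi ->
        F (fun x => phiA (fun a => x (Some (inl a))) *
                    phiB (fun b => x (Some (inr b))) * psi (x None)) =
        cintegral (fun y => g1 y * g2 y * psi y)].

Definition gtof (le : M -> M -> Prop) (W : finType)
    (t : seq {set W} -> (M ^^ W -> C) -> C) : Prop :=
  [/\ forall s, proper_sequence s -> distribution (t s),
      forall s, proper_sequence s -> partially_regular (t s) &
      forall P Q : {set W}, bipartition P Q ->
      forall s, proper_sequence s ->
        vanishes_on
          [set x | forall j k, j \in P -> k \in Q -> ~ le (x j) (x k)]
          (fun f => t s f - t (refine_seq P Q s) f)].

End Density.

Definition generalized_retarded (W : finType)
    (t : seq {set W} -> (M ^^ W -> C) -> C) (S : {set {set W}}) :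
    (M ^^ W -> C) -> C :=
  fun f => \sum_(1 <= nu < #|W|.+1)
    (-1) ^+ nu.-1 * \sum_(s : nu.-tuple {set W} | in_M (opposite S) s) t s f.

End Distributions.

(* Main.v *)
Require Import Defs.
From mathcomp Require Import all_boot all_order all_algebra.
From mathcomp Require Import complex.
From mathcomp Require Import lra ring.

(* Let c be weights defining the cell S, and let c_A, c_B be the weights induced
   on A u {1} and B u {1}, the weight of 1 being changed to make the sums zero.
   Then S, S_A, S_B consist of the sets of positive weight, and the weight of a
   set is the sum of the weights of its traces on A u {1} and B u {1}.
   Membership of a proper sequence in M(S') says that its proper partial unions
   have negative weight. Grouping the terms of r_S by their restrictions a and b
   to A u {1} and B u {1}, the theorem reduces to computing the signed number of
   s in M(S') lying over a given pair (a, b). Such an s is a quasi-shuffle of the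
   blocks of a and b preceding 1, then the union of the two blocks containing 1,
   then a quasi-shuffle of the blocks following 1; the signed count of each of
   the two quasi-shuffles satisfies a recursion whose solution is supported on
   the pairs in M(S_A') x M(S_B'). *)

Set Implicit Arguments.
Unset Strict Implicit.
Unset Printing Implicit Defensive.
Import Order.TTheory GRing.Theory Num.Theory.
Local Open Scope ring_scope.

(** * Prefix and suffix sums, proper sequences *)

Section SuffixSums.
Context {R : realFieldType}.
Implicit Types (l : seq R) (t x : R).

(** With suffixes, the condition at the head of a list bears only on its total sum, which suits
    recursions removing the first block. *)
Fixpoint pos_suffixes t l : bool :=
  if l is x :: l' then (0 < t + \sum_(y <- l) y) && pos_suffixes t l' else true.

Fixpoint neg_prefixes t l : bool :=
  if l is x :: l' then (t + x < 0) && neg_prefixes (t + x) l' else true.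

Lemma pos_suffixes_rcons t l x :
  pos_suffixes t (rcons l x) = pos_suffixes (t + x) l && (0 < t + x).
Proof.
elim: l => [|y l IHl] /=; first by rewrite big_seq1 andbT.
rewrite IHl !big_cons -cats1 big_cat big_seq1 andbA; congr (_ && _ && _).
by congr (0 < _) => /=; lra.
Qed.

(** Reversal exchanges prefixes and suffixes, negation the inequalities. This reduces the blocks
    before 1 to the case of the blocks after 1. *)
Lemma neg_prefixesE t l :
  neg_prefixes t l = pos_suffixes (- t) [seq - x | x <- rev l].
Proof.
elim: l t => [|x l IHl] t //=.
rewrite rev_cons map_rcons pos_suffixes_rcons IHl opprD andbC.
by congr (_ && _); rewrite -opprD oppr_gt0.
Qed.

(** As the total is zero, a suffix is positive exactly when the prefix before it, with its offset,
    is negative; this is applied to the suffixes starting in [l0] or at [z]. [behead] removes the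
    full suffix. *)
Lemma pos_suffixes_behead t l0 z l1 :
  t + \sum_(y <- l0 ++ z :: l1) y = 0 ->
  pos_suffixes 0 (behead (l0 ++ z :: l1)) =
  neg_prefixes t l0 && pos_suffixes 0 l1.
Proof.
elim: l0 t => [|x l0 IHl] t //=; rewrite big_cons addrA => sum0.
rewrite -andbA -(IHl _ sum0); case: l0 {IHl} sum0 => [|y l0] /= sum0;
  by congr (_ && _); apply/idP/idP; lra.
Qed.

Lemma pos_suffixesP l :
  reflect (forall r, (r < size l)%N -> 0 < \sum_(y <- drop r l) y)
          (pos_suffixes 0 l).
Proof.
elim: l => [|x l IHl] /=; first by left.
rewrite add0r; apply: (iffP andP) => [[xl /IHl lP] [|r]//|H].
  by rewrite ltnS => /lP.
by split; [exact: (H 0%N)|apply/IHl => r rl; exact: (H r.+1)].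
Qed.

End SuffixSums.

(** * Sequences of bounded length *)

Section SequencesOfBoundedLength.
Context {T : finType}.
Implicit Types (n : nat) (P : pred (seq T)).

(** One list for all lengths from 1 to [n]: restriction to A u {1} or B u {1} changes the length, so
    the sums are regrouped across lengths. *)
Definition seqs n : seq (seq T) :=
  flatten [seq [seq tval s | s : nu.-tuple T] | nu <- iota 1 n].

Lemma mem_seqs n (s : seq T) : (s \in seqs n) = (0 < size s <= n)%N.
Proof.
apply/flatten_mapP/idP => [[nu]|sz].
  by rewrite mem_iota add1n ltnS => nun /mapP[x _ ->]; rewrite size_tuple.
exists (size s); first by rewrite mem_iota add1n ltnS.
by apply/mapP; exists (in_tuple s) => //; rewrite mem_enum.
Qed.

Lemma seqs_uniq n : uniq (seqs n).
Proof.
rewrite /seqs; elim: n 1%N => [|n IHn] m //=.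
rewrite cat_uniq IHn map_inj_uniq ?enum_uniq; last exact: val_inj.
rewrite andbT; apply/hasPn => s /flatten_mapP[nu].
rewrite mem_iota => /andP[mnu _] /mapP[x _ ->].
apply/mapP => -[y _ /(congr1 size)]; rewrite !size_tuple => E.
by rewrite E ltnn in mnu.
Qed.

Lemma big_seqs (V : nzRingType) n P (F : seq T -> V) :
  \sum_(1 <= nu < n.+1) (-1) ^+ nu.-1 * \sum_(s : nu.-tuple T | P s) F s =
  \sum_(s <- seqs n | P s) (-1) ^+ (size s).-1 * F s.
Proof.
rewrite /seqs big_flatten big_map /index_iota subSS subn0.
apply: eq_bigr => nu _; rewrite big_map big_enum_cond mulr_sumr.
by apply: eq_bigr => s _; rewrite size_tuple.
Qed.

End SequencesOfBoundedLength.

(** * Proper sequences and the weights of a cell *)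

Section ProperSequences.
Context {W : finType} {R : realFieldType}.
Implicit Types (S : {set {set W}}) (s : seq {set W}) (c : W -> R).

Definition weight c (J : {set W}) : R := \sum_(j in J) c j.

Definition positive_sets c : {set {set W}} := [set J in Pstar | 0 < weight c J].

Lemma weight0 c : weight c set0 = 0. Proof. by rewrite /weight big_set0. Qed.

Lemma weightC c J : \sum_j c j = 0 -> weight c (~: J) = - weight c J.
Proof.
move=> c0; apply/eqP; rewrite -addr_eq0 addrC -c0 /weight.
rewrite [X in _ == X](bigID (mem J)) /=.
by apply/eqP; congr (_ + _); apply: eq_bigl => j; rewrite inE.
Qed.

Lemma Pstar_setC (J : {set W}) : (~: J \in Pstar) = (J \in Pstar).
Proof.
rewrite !inE -(inj_eq (@setC_inj W) _ set0) -(inj_eq (@setC_inj W) _ setT).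
by rewrite setCK setC0 setCT andbC.
Qed.

(** By the precell condition, a member of [Pstar] outside [S] has its complement in [S], hence
    negative weight. So the signs of the weights determine the cell. *)
Lemma cellE S : cell R S ->
  exists2 c : W -> R, \sum_j c j = 0 & S = positive_sets c.
Proof.
move=> [[[_ /subsetP SP _] SS] [c [c0 cS]]]; exists c => //.
apply/setP => J; rewrite inE.
apply/idP/andP => [JS|[JP Jgt0]]; first by split; [exact: SP|exact: cS].
move: JP; rewrite -SS inE [J \in opposite S]inE => /orP[//|/cS].
by rewrite -/(weight c (~: J)) weightC// oppr_gt0 ltNge ltW.
Qed.

Lemma disjoint_bigcup (U : {set W}) s :
  all (fun J : {set W} => [disjoint U & J]) s -> [disjoint U & \bigcup_(J <- s) J].
Proof.
move=> /allP Us; rewrite big_seq disjoint_sym.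
elim/big_ind: _ => [|X Y XU YU|J /Us]; first by rewrite -setI_eq0 set0I.
  by rewrite -setI_eq0 setIUl setU_eq0 !setI_eq0 XU.
by rewrite disjoint_sym.
Qed.

Lemma weight_bigcup c s :
  pairwise (fun I J : {set W} => [disjoint I & J]) s ->
  weight c (\bigcup_(J <- s) J) = \sum_(J <- s) weight c J.
Proof.
elim: s => [|J s IHs] /= ps; first by rewrite !big_nil weight0.
rewrite !big_cons -IHs; last by case/andP: ps.
rewrite /weight -bigU /=; last by apply: disjoint_bigcup; case/andP: ps.
by apply: eq_bigl => j; rewrite !inE.
Qed.

Lemma bigcup_neq0 s : s != [::] -> set0 \notin s -> \bigcup_(J <- s) J != set0.
Proof.
case: s => // J s _; rewrite inE negb_or big_cons setU_eq0 eq_sym.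
by case/andP=> /negPf->.
Qed.

(** The complement of a partial union is the union of the remaining blocks. [behead] removes the
    full suffix, that of r = 0, on which M(S') imposes nothing. *)
Lemma in_M_positive c s : \sum_j c j = 0 ->
  in_M (opposite (positive_sets c)) s =
  proper_sequence s && pos_suffixes 0 (behead [seq weight c J | J <- s]).
Proof.
move=> c0; rewrite /in_M; case: (boolP (proper_sequence s)) => //= /and3P[s0 sd].
move=> /eqP sT.
have sdrop r : ~: (\bigcup_(J <- take r s) J) = \bigcup_(J <- drop r s) J.
  move: sT sd; rewrite -[in X in X -> _](cat_take_drop r s) big_cat /= => sT.
  rewrite -[in X in X -> _](cat_take_drop r s) pairwise_cat => /and3P[sd _ _].
  apply/setP => j; rewrite inE.
  have : [disjoint \bigcup_(J <- take r s) J & \bigcup_(J <- drop r s) J].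
    apply: disjoint_bigcup; apply/allP => K Kd; rewrite disjoint_sym.
    apply: disjoint_bigcup; apply/allP => L Lt; rewrite disjoint_sym.
    exact: (allrelP sd).
  have : j \in setT by []. rewrite -sT inE.
  move=> jU /setDidPl/setP/(_ j); rewrite inE.
  by case: (_ \in _) jU; case: (_ \in _).
have Mr r : (0 < r < size s)%N -> (\bigcup_(J <- take r s) J
    \in opposite (positive_sets c)) = (0 < \sum_(J <- drop r s) weight c J).
  move=> r0s; rewrite 2!inE sdrop weight_bigcup; last first.
    by move: sd; rewrite -[s in pairwise _ s](cat_take_drop r) pairwise_cat => /and3P[].
  (* For 0 < r < [size s] membership in [Pstar] is automatic, since some non-empty block is taken
     and some is dropped. *)
  rewrite andb_idl// => _; rewrite inE -(inj_eq (@setC_inj W) _ setT) setCT -sdrop setCK.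
  case/andP: r0s => r0 rs; move: s0.
  rewrite -{1}(cat_take_drop r s) mem_cat negb_or => /andP[t0 d0].
  by rewrite sdrop !bigcup_neq0// -size_eq0 ?size_drop ?size_take ?rs -lt0n ?subn_gt0.
(* Suffix [r] of the beheaded list is suffix [r.+1] of the weights of [s]. *)
apply/forallP/pos_suffixesP => [H r|H r].
  rewrite size_behead size_map => rs; rewrite -drop1 drop_drop addn1 -map_drop big_map.
  have rs' : (r.+1 < size s)%N by case: (size s) rs.
  by rewrite -Mr ?rs'//; have /implyP := H (Ordinal rs'); apply.
apply/implyP => r0; rewrite Mr ?r0//=.
have := H r.-1; rewrite size_behead size_map -drop1 drop_drop addn1 prednK//.
rewrite -map_drop big_map; apply.
have := ltn_ord r.
by move: r0; case: (r : nat) => // k _; case: (size s).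
Qed.

End ProperSequences.

(** * Induced cells *)

Section InducedCells.
Context {A W : finType} {R : realFieldType}.

Definition induced_weight (h : option A -> W) (c : W -> R) (i : option A) : R :=
  if i is Some a then c (h (Some a)) else - \sum_(a : A) c (h (Some a)).

Lemma big_option (T : finType) (F : option T -> R) :
  \sum_j F j = F None + \sum_(a : T) F (Some a).
Proof.
rewrite (bigD1 None)//=; congr (_ + _).
rewrite (reindex_omap (fun a : T => Some a) id)//=; last by case.
by apply: eq_bigl => a; rewrite eqxx.
Qed.

Lemma sum_induced_weight h c : \sum_j induced_weight h c j = 0.
Proof. by rewrite big_option addNr. Qed.

Lemma weight_imset h c (J : {set option A}) : injective h -> None \notin J ->
  weight c (h @: J) = weight (induced_weight h c) J.
Proof.
move=> h_inj NJ; rewrite /weight big_imset/=; last by move=> x y _ _ /h_inj.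
by apply: eq_bigr => -[a|]//; rewrite (negPf NJ).
Qed.

(** For J containing 1 the definition tests A \ J against S'. Since the induced weights sum to zero,
    A \ J and J have opposite weights, and both clauses amount to J having positive weight. *)
Lemma induced_cell_positive h c : injective h -> \sum_j c j = 0 ->
  induced_cell h (positive_sets c) = positive_sets (induced_weight h c).
Proof.
move=> h_inj c0; have hP (J : {set option A}) : J != set0 -> None \notin J -> h @: J \in Pstar.
  move=> J0 NJ; rewrite inE imset_eq0 J0; apply/eqP => hT.
  have : h None \in h @: J by rewrite hT inE.
  by rewrite mem_imset// (negPf NJ).
apply/setP => J; rewrite [in RHS]inE [in LHS]inE.
rewrite [X in X || _]inE [X in _ || X]inE -andb_orr.
apply: andb_id2l; rewrite inE => /andP[J0 JT].
case: (boolP (None \in J)) => NJ; rewrite /= ?orbF.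
  have NC : None \notin ~: J by rewrite inE NJ.
  have -> : [set~ None] :\: J = ~: J.
    by apply/setP => -[a|]; rewrite !inE ?NJ ?andbT.
  rewrite !inE weightC// weight_imset// weightC ?sum_induced_weight// opprK.
  rewrite -[X in X && _]/((_ != _) && _) andb_idl// => _.
  have := hP (~: J) _ NC; rewrite -Pstar_setC !inE => -> //.
  by rewrite -(inj_eq (@setC_inj _)) setCK setC0.
rewrite inE weight_imset// hP//.
Qed.
End InducedCells.

(** * Sets with given traces on A u {1} and B u {1} *)

Section Glue.
Context {A B : finType} {R : realFieldType}.
Local Notation W := (option (A + B)).
Local Notation preA := (fun J : {set W} => inA A B @^-1: J).
Local Notation preB := (fun J : {set W} => inB A B @^-1: J).
Implicit Types (J : {set W}) (X : {set option A}) (Y : {set option B}).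

(** Inverse to taking the two traces when [X] and [Y] agree about 1. If only one of them contains 1,
    the result contains it too, whence the conditions on [None] below. *)
Definition glue X Y : {set W} := inA A B @: X :|: inB A B @: Y.

Lemma inA_inj : injective (inA A B). Proof. by move=> [a|] [a'|] //= [->]. Qed.
Lemma inB_inj : injective (inB A B). Proof. by move=> [a|] [a'|] //= [->]. Qed.

Lemma in_glueA X Y a : (Some (inl a) \in glue X Y) = (Some a \in X).
Proof.
rewrite inE (mem_imset _ (Some a) inA_inj); apply: orb_idr.
by case/imsetP => -[].
Qed.

Lemma in_glueB X Y b : (Some (inr b) \in glue X Y) = (Some b \in Y).
Proof.
rewrite inE (mem_imset _ (Some b) inB_inj); apply: orb_idl.
by case/imsetP => -[].
Qed.

Lemma in_glueN X Y : (None \in glue X Y) = (None \in X) || (None \in Y).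
Proof.
by rewrite inE (mem_imset _ None inA_inj) (mem_imset _ None inB_inj).
Qed.

Lemma glue_preim J : glue (preA J) (preB J) = J.
Proof.
by apply/setP => -[[a|b]|]; rewrite ?in_glueA ?in_glueB ?in_glueN !inE ?orbb.
Qed.

Lemma preimA_glue X Y : (None \in Y -> None \in X) -> preA (glue X Y) = X.
Proof.
move=> YX; apply/setP => -[a|]; rewrite inE ?in_glueA//= in_glueN.
exact: orb_idr.
Qed.

Lemma preimB_glue X Y : (None \in X -> None \in Y) -> preB (glue X Y) = Y.
Proof.
move=> YX; apply/setP => -[a|]; rewrite inE ?in_glueB//= in_glueN.
exact: orb_idl.
Qed.

(** If 1 lies in both sets, the two induced values at 1 add up to minus the sum of [c] over A and B,
    which is [c None] because [c] has total zero. *)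
Lemma weight_glue (c : W -> R) X Y : \sum_j c j = 0 ->
  (None \in X) = (None \in Y) ->
  weight c (glue X Y) = weight (induced_weight (inA A B) c) X +
                        weight (induced_weight (inB A B) c) Y.
Proof.
rewrite big_option big_sumType /= => c0 XY.
have wE (T : finType) (d : T -> R) (K : {set T}) :
    weight d K = \sum_j if j \in K then d j else 0.
  by rewrite /weight big_mkcond.
rewrite !wE !big_option big_sumType /= in_glueN XY orbb.
rewrite (eq_bigr (fun a => if Some a \in X then c (Some (inl a)) else 0));
  last by move=> a _; rewrite in_glueA.
rewrite [X in _ + (_ + X) = _](eq_bigr (fun b => if Some b \in Y then c (Some (inr b)) else 0));
  last by move=> b _; rewrite in_glueB.
by case: ifP => _; lra.
Qed.

End Glue.

(** * Quasi-shuffles *)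

Section QuasiShuffles.
Context {A B : finType}.
Local Notation W := (option (A + B)).
Local Notation rA := (restrict_seq (inA A B)).
Local Notation rB := (restrict_seq (inB A B)).
Implicit Types (s : seq {set W}) (a : seq {set option A}) (b : seq {set option B}).
Implicit Types (x : {set option A}) (y : {set option B}).

(** The next block is the next one of [a], the next one of [b], or their union. The inner [fix]
    allows either list to be shortened. *)
Fixpoint quasi_shuffles a : seq {set option B} -> seq (seq {set W}) :=
  fix qs b := match a, b with
  | [::], [::] => [:: [::]]
  | x :: a', [::] => map (cons (glue x set0)) (quasi_shuffles a' b)
  | [::], y :: b' => map (cons (glue set0 y)) (qs b')
  | x :: a', y :: b' =>
      map (cons (glue x set0)) (quasi_shuffles a' b) ++
      map (cons (glue set0 y)) (qs b') ++
      map (cons (glue x y)) (quasi_shuffles a' b')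
  end.

Lemma quasi_shuffles0s y b :
  quasi_shuffles [::] (y :: b) = map (cons (glue set0 y)) (quasi_shuffles [::] b).
Proof. by []. Qed.

Lemma quasi_shuffless0 x a :
  quasi_shuffles (x :: a) [::] = map (cons (glue x set0)) (quasi_shuffles a [::]).
Proof. by []. Qed.

Lemma quasi_shufflesss x a y b : quasi_shuffles (x :: a) (y :: b) =
  map (cons (glue x set0)) (quasi_shuffles a (y :: b)) ++
  map (cons (glue set0 y)) (quasi_shuffles (x :: a) b) ++
  map (cons (glue x y)) (quasi_shuffles a b).
Proof. by []. Qed.

(** Blocks without 1 can stand alone or be merged with a block of the other side; a block with 1
    must meet its counterpart. *)
Definition avoid1 (T : finType) (a : seq {set option T}) : bool :=
  all (fun J : {set option T} => (J != set0) && (None \notin J)) a.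

Lemma mem_map_cons (T : eqType) (z w : T) (s : seq T) (l : seq (seq T)) :
  (z :: s \in map (cons w) l) = (z == w) && (s \in l).
Proof.
by apply/mapP/andP => [[s' sl [-> ->]]|[/eqP-> sl]]; last exists s.
Qed.

Lemma nil_map_cons (T : eqType) (z : T) (l : seq (seq T)) :
  ([::] \in map (cons z) l) = false.
Proof. by apply/mapP => -[]. Qed.

Lemma restrict_cons (V U : finType) (h : V -> U) (J : {set U}) (s : seq {set U}) :
  restrict_seq h (J :: s) =
  if h @^-1: J == set0 then restrict_seq h s
  else h @^-1: J :: restrict_seq h s.
Proof. by rewrite /restrict_seq /=; case: eqP. Qed.

Lemma glue_eq0 x y : (glue x y == set0 :> {set W}) = (x == set0) && (y == set0).
Proof. by rewrite setU_eq0 !imset_eq0. Qed.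

Lemma glue_eq x y (J : {set W}) : (None \in x) = (None \in y) ->
  (J == glue x y) = (inA A B @^-1: J == x) && (inB A B @^-1: J == y).
Proof.
move=> xy; apply/eqP/andP => [->|[/eqP<- /eqP<-]]; last by rewrite glue_preim.
by rewrite preimA_glue ?preimB_glue ?xy.
Qed.

(** Induction on [s]: which of the two traces of its first block is empty decides the case of the
    recursion; they are not both empty. *)
Lemma mem_quasi_shuffles a b s : avoid1 a -> avoid1 b ->
  (s \in quasi_shuffles a b) = [&& set0 \notin s, rA s == a & rB s == b].
Proof.
elim: s a b => [|J s IHs] a b aa ab.
  by case: a aa => [|x a] _; case: b ab => [|y b] _;
    rewrite /= ?mem_cat ?nil_map_cons ?inE ?eqxx.
rewrite !restrict_cons !inE negb_or -[in set0 != J](glue_preim J).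
rewrite [set0 == _]eq_sym glue_eq0.
case: a aa => [|x a] aa; case: b ab => [|y b] ab;
  rewrite ?quasi_shuffles0s ?quasi_shuffless0 ?quasi_shufflesss.
- by case: eqP; case: eqP; rewrite /= ?andbF.
- have /andP[/andP[y0 Ny] ab'] := ab.
  rewrite mem_map_cons IHs// glue_eq ?inE ?(negPf Ny)//.
  move: (inA A B @^-1: J) (inB A B @^-1: J) => U V.
  case: (eqVneq U set0) => U0; case: (eqVneq V set0) => V0;
    rewrite ?U0 ?V0 ?eqseq_cons ?[set0 == y]eq_sym ?(negPf y0) /= ?andbF ?orbF//;
    by do ?case: (_ == _); do ?case: (_ \in _).
- have /andP[/andP[x0 Nx] aa'] := aa.
  rewrite mem_map_cons IHs// glue_eq ?inE ?(negPf Nx)//.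
  move: (inA A B @^-1: J) (inB A B @^-1: J) => U V.
  case: (eqVneq U set0) => U0; case: (eqVneq V set0) => V0;
    rewrite ?U0 ?V0 ?eqseq_cons ?[set0 == x]eq_sym ?(negPf x0) /= ?andbF ?orbF//;
    by do ?case: (_ == _); do ?case: (_ \in _).
have /andP[/andP[x0 Nx] aa'] := aa; have /andP[/andP[y0 Ny] ab'] := ab.
rewrite !mem_cat !mem_map_cons !IHs// !glue_eq ?inE ?(negPf Nx) ?(negPf Ny)//.
move: (inA A B @^-1: J) (inB A B @^-1: J) => U V.
  case: (eqVneq U set0) => U0; case: (eqVneq V set0) => V0;
  rewrite ?U0 ?V0 ?eqseq_cons ?[set0 == x]eq_sym ?[set0 == y]eq_sym ?(negPf x0) ?(negPf y0) /= ?andbF ?orbF//;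
    by do ?case: (_ == _); do ?case: (_ \in _).
Qed.

(** The three possible first blocks are distinct because [x] and [y] are non-empty. *)
Lemma quasi_shuffles_uniq a b : avoid1 a -> avoid1 b -> uniq (quasi_shuffles a b).
Proof.
have map_cons_uniq (T : eqType) (z : T) l : uniq (map (cons z) l) = uniq l.
  by rewrite map_inj_uniq// => s1 s2 [].
have disj (z w : {set W}) (l l' : seq (seq {set W})) : z != w ->
    ~~ has (mem (map (cons z) l)) (map (cons w) l').
  move=> zw; apply/hasPn => _ /mapP[s _ ->] /=.
  by rewrite mem_map_cons eq_sym (negPf zw).
elim: a b => [|x a IHa]; elim=> [|y b IHb] // aa ab.
- have /andP[/andP[y0 Ny] ab'] := ab.
  by rewrite quasi_shuffles0s map_cons_uniq IHb.
- have /andP[/andP[x0 Nx] aa'] := aa.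
  by rewrite quasi_shuffless0 map_cons_uniq IHa.
have /andP[/andP[x0 Nx] aa'] := aa; have /andP[/andP[y0 Ny] ab'] := ab.
rewrite quasi_shufflesss !cat_uniq !map_cons_uniq !IHa// IHb// has_cat negb_or.
rewrite !disj// glue_eq ?preimA_glue ?preimB_glue ?inE ?(negPf Nx) ?(negPf Ny)//;
  by rewrite ?(eq_sym set0) negb_and ?x0 ?y0 ?orbT.
Qed.

(** * Signed count of quasi-shuffles *)

Section SignedSum.
Context {R : realFieldType} {V : comNzRingType}.
Variables (w : {set W} -> R) (wA : {set option A} -> R) (wB : {set option B} -> R).
Hypotheses (wA0 : wA set0 = 0) (wB0 : wB set0 = 0).
Hypothesis w_glue : forall x y, None \notin x -> None \notin y ->
  w (glue x y) = wA x + wB y.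

(** All quasi-shuffles of [a] and [b] have the same total weight, so the condition on the full
    suffix depends on [a] and [b] alone. *)
Lemma sum_quasi_shuffle a b s : avoid1 a -> avoid1 b -> s \in quasi_shuffles a b ->
  \sum_(J <- s) w J = \sum_(x <- a) wA x + \sum_(y <- b) wB y.
Proof.
elim: a b s => [|x a IHa]; elim=> [|y b IHb] s aa ab.
- by rewrite inE => /eqP->; rewrite !big_nil addr0.
- have /andP[/andP[y0 Ny] ab'] := ab.
  rewrite quasi_shuffles0s => /mapP[s' s'qs ->].
  by rewrite !big_cons w_glue ?inE// (IHb s')// wA0 !big_nil !add0r.
- have /andP[/andP[x0 Nx] aa'] := aa.
  rewrite quasi_shuffless0 => /mapP[s' s'qs ->].
  by rewrite !big_cons w_glue ?inE// (IHa [::] s')// wB0 !big_nil !addr0.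
have /andP[/andP[x0 Nx] aa'] := aa; have /andP[/andP[y0 Ny] ab'] := ab.
rewrite quasi_shufflesss !mem_cat => /or3P[] /mapP[s' s'qs ->].
- by rewrite !big_cons w_glue ?inE// (IHa (y :: b) s')// wB0 big_cons; lra.
- by rewrite !big_cons w_glue ?inE// (IHb s')// wA0 big_cons; lra.
- by rewrite !big_cons w_glue ?inE// (IHa b s')//; lra.
Qed.

(** The weights are abstract because two cases are needed: the weights of the cell for the blocks
    after 1, and their negatives for the reversed blocks before 1. *)
Definition signed_sum a b : V := \sum_(s <- quasi_shuffles a b)
  (-1) ^+ size s * (pos_suffixes 0 [seq w J | J <- s])%:R.

(** A new first block costs a sign and one condition, which is the same for all the quasi-shuffles
    and leaves the sum. *)
Lemma signed_sum_map_cons J a b : avoid1 a -> avoid1 b ->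
  \sum_(s <- map (cons J) (quasi_shuffles a b))
    (-1) ^+ size s * (pos_suffixes 0 [seq w J | J <- s])%:R =
  - (0 < w J + (\sum_(x <- a) wA x + \sum_(y <- b) wB y))%R%:R * signed_sum a b :> V.
Proof.
move=> aa ab; rewrite big_map /signed_sum mulr_sumr [LHS]big_seq [RHS]big_seq.
apply: eq_bigr => s sqs; rewrite /= add0r big_cons big_map.
by rewrite (sum_quasi_shuffle aa ab sqs) exprS -mulnb natrM; ring.
Qed.

(* In a rectangle of partial sums, if the total weight of b is not positive while
   that of a is, then removing the first block of b and removing the first blocks
   of both contribute opposite terms; if neither is positive, the sum is empty. *)
Lemma signed_sumE a b : avoid1 a -> avoid1 b ->
  signed_sum a b = (-1) ^+ (size a + size b) *
    (pos_suffixes 0 [seq wA x | x <- a] && pos_suffixes 0 [seq wB y | y <- b])%:R.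
Proof.
elim: a b => [|x a IHa]; elim=> [|y b IHb] aa ab.
- by rewrite /signed_sum big_seq1.
- have /andP[/andP[y0 Ny] ab'] := ab.
  rewrite /signed_sum quasi_shuffles0s signed_sum_map_cons// IHb// w_glue ?inE//.
  rewrite wA0 big_nil !add0r /= add0r exprS big_cons big_map -mulnb natrM.
  by rewrite /=; ring.
- have /andP[/andP[x0 Nx] aa'] := aa.
  rewrite /signed_sum quasi_shuffless0 signed_sum_map_cons// IHa// w_glue ?inE//.
  rewrite wB0 big_nil !addr0 /= add0r exprS big_cons big_map !andbT -mulnb natrM.
  by rewrite /=; ring.
have /andP[/andP[x0 Nx] aa'] := aa; have /andP[/andP[y0 Ny] ab'] := ab.
rewrite /signed_sum quasi_shufflesss !big_cat !signed_sum_map_cons//.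
rewrite !w_glue ?inE// wA0 wB0 IHb// !IHa//=.
rewrite !add0r !addr0 !big_cons !big_map !addnS !addSn !exprS.
set a' := \sum_(x <- a) _; set b' := \sum_(y <- b) _.
(* The new condition bears on the whole sequence, so the three kinds of first block yield the same
   inequality. *)
have -> : wA x + (a' + (wB y + b')) = (wA x + a') + (wB y + b') by ring.
have -> : wB y + (wA x + a' + b') = (wA x + a') + (wB y + b') by ring.
have -> : wA x + wB y + (a' + b') = (wA x + a') + (wB y + b') by ring.
case: (ltrP 0 (wA x + a')) => xa; case: (ltrP 0 (wB y + b')) => yb;
  rewrite ?(addr_gt0 xa yb) ?andbF /=.
(* Both totals positive: relative to the expected sign, the two unmerged first blocks contribute 1
   each and the merged one -1. *)
- by ring.
- by ring.
- by ring.
have /negPf -> : ~~ (0 < (wA x + a') + (wB y + b')) by rewrite -leNgt; lra.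
by rewrite /=; ring.
Qed.
End SignedSum.

End QuasiShuffles.

(** * Splitting proper sequences at the block of 1 *)

Section ProperSplit.
Context {R : realFieldType}.

Lemma proper_split (T : finType) (a : seq {set option T}) : proper_sequence a ->
  exists a0 x a1, [/\ a = a0 ++ x :: a1, avoid1 a0, avoid1 a1 & None \in x].
Proof.
move=> /and3P[a_ne0 a_disj /eqP aT].
have [x xa Nx] : exists2 x : {set option T}, x \in a & None \in x.
  have : None \in \bigcup_(J <- a) J.
    by rewrite aT inE.
  rewrite big_seq.
  apply: (big_ind (fun U : {set _} => None \in U -> exists2 x, x \in a & None \in x))
    => [|U V IU IV|J Ja NJ]; first by rewrite inE.
    by rewrite inE => /orP[/IU|/IV].
  by exists J.
case/splitPr: xa a_ne0 a_disj {aT} => a0 a1.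
rewrite mem_cat inE !negb_or => /and3P[a00 _ a10].
rewrite pairwise_cat => /and3P[/allrelP d0 _ /= /andP[/allP d1 _]].
have xN J : [disjoint J & x] -> None \notin J.
  by move=> /pred0P/(_ None) /=; rewrite Nx andbT => ->.
exists a0, x, a1; split=> //; apply/allP => J Ja; apply/andP; split.
- by apply: contraNneq a00 => <-.
- by apply/xN/d0; rewrite ?inE ?eqxx.
- by apply: contraNneq a10 => <-.
- by apply: xN; rewrite disjoint_sym; apply: d1.
Qed.

Lemma sum_weight_proper (T : finType) (c : T -> R) (s : seq {set T}) :
  \sum_j c j = 0 -> proper_sequence s -> \sum_(J <- s) weight c J = 0.
Proof.
move=> c0 /and3P[_ sd /eqP sT]; rewrite -weight_bigcup// sT -[RHS]c0.
by apply: eq_bigl => j; rewrite inE.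
Qed.

(** Prefixes of [s0] must be negative and suffixes of [s1] positive; the weight of [x] itself drops
    out. The former condition is rewritten for the reversed list with negated weights. *)
Lemma in_M_cat (T : finType) (c : T -> R) s0 (x : {set T}) s1 :
  \sum_j c j = 0 -> proper_sequence (s0 ++ x :: s1) ->
  in_M (opposite (positive_sets c)) (s0 ++ x :: s1) =
  pos_suffixes 0 [seq - weight c J | J <- rev s0] &&
  pos_suffixes 0 [seq weight c J | J <- s1].
Proof.
move=> c0 ps; rewrite in_M_positive// ps map_cat /= (@pos_suffixes_behead _ 0).
  by rewrite neg_prefixesE oppr0 -map_rev -map_comp.
by rewrite -map_cons -map_cat big_map sum_weight_proper// addr0.
Qed.

Lemma size_proper (T : finType) (i : T) (s : seq {set T}) :
  proper_sequence s -> (0 < size s <= #|T|)%N.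
Proof.
case: s => [/and3P[_ _]|J s].
  by rewrite big_nil => /eqP/setP/(_ i); rewrite !inE.
have: (0 < size (J :: s))%N by []; move: (J :: s) => {J}{}s sgt0 /and3P[s0 sd /eqP sT].
rewrite sgt0 /= -(ler_nat rat).
(* With constant weight 1, additivity counts the points of the disjoint blocks, each of which has at
   least one. *)
have := weight_bigcup (fun=> 1 : rat) sd; rewrite sT /weight sumr_const cardsT => ->.
rewrite -sum1_size natr_sum big_seq [leRHS]big_seq; apply: ler_sum => J Js.
by rewrite sumr_const ler1n card_gt0; apply: contraNneq s0 => <-.
Qed.

End ProperSplit.

(** * Restriction of proper sequences, reversal of quasi-shuffles *)

Section Restrict.
Context {A B : finType}.
Local Notation W := (option (A + B)).
Local Notation rA := (restrict_seq (inA A B)).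
Local Notation rB := (restrict_seq (inB A B)).
Implicit Types (s : seq {set W}) (a : seq {set option A}) (b : seq {set option B}).

Lemma bigcup_restrict (V U : finType) (h : V -> U) (s : seq {set U}) :
  \bigcup_(J <- restrict_seq h s) J = h @^-1: \bigcup_(J <- s) J.
Proof.
elim: s => [|J s IHs]; first by rewrite !big_nil preimset0.
rewrite restrict_cons big_cons preimsetU -IHs; case: eqP => [->|_].
  by rewrite set0U.
by rewrite big_cons.
Qed.

Lemma pairwise_restrict (V U : finType) (h : V -> U) (s : seq {set U}) :
  pairwise (fun I J : {set V} => [disjoint I & J]) (restrict_seq h s) =
  pairwise (fun I J : {set U} => [disjoint h @^-1: I & h @^-1: J]) s.
Proof.
elim: s => [|J s IHs] //; rewrite restrict_cons /= -IHs.
case: eqP => [J0|_] /=.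
  by rewrite andb_idl// => _; apply/allP => I _; rewrite J0 -setI_eq0 set0I.
congr (_ && _); rewrite all_filter all_map; apply: eq_all => I /=.
by apply/implyP/idP => [|//]; case: eqP => [->|_]; [rewrite -setI_eq0 setI0|apply].
Qed.

(** A set is empty, or everything, exactly when both its traces are, so disjointness and covering
    can be tested on traces. Non-emptiness of the blocks is separate, as restriction omits empty
    traces. *)
Lemma proper_restrict s : proper_sequence s =
  [&& set0 \notin s, proper_sequence (rA s) & proper_sequence (rB s)].
Proof.
rewrite /proper_sequence !pairwise_restrict !bigcup_restrict.
rewrite !mem_filter !eqxx /= -!andbA; congr (_ && _).
have -> : pairwise (fun I J : {set W} => [disjoint I & J]) s =
    pairwise [rel I J : {set W} | [disjoint inA A B @^-1: I & inA A B @^-1: J] &&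
                        [disjoint inB A B @^-1: I & inB A B @^-1: J]] s.
  apply: eq_pairwise => I J /=.
  rewrite -!setI_eq0 -!preimsetI.
  by rewrite -{1}(glue_preim (I :&: J)) glue_eq0.
rewrite pairwise_relI -!andbA; congr (_ && _); rewrite andbCA; congr (_ && _).
set U := \bigcup_(J <- s) J.
apply/eqP/andP => [->|[/eqP UA /eqP UB]]; first by rewrite !preimsetT.
by rewrite -(glue_preim U) UA UB -[RHS](glue_preim setT) !preimsetT.
Qed.

Lemma restrict_cat (V U : finType) (h : V -> U) (s1 s2 : seq {set U}) :
  restrict_seq h (s1 ++ s2) = restrict_seq h s1 ++ restrict_seq h s2.
Proof. by rewrite /restrict_seq map_cat filter_cat. Qed.

Lemma restrict_rev (V U : finType) (h : V -> U) (s : seq {set U}) :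
  restrict_seq h (rev s) = rev (restrict_seq h s).
Proof. by rewrite /restrict_seq map_rev filter_rev. Qed.

(** The recursion treats the two ends differently, but the characterization of quasi-shuffles by
    their restrictions is invariant under reversal. *)
Lemma perm_rev_quasi_shuffles a b : avoid1 a -> avoid1 b ->
  perm_eq (map rev (quasi_shuffles a b)) (quasi_shuffles (rev a) (rev b)).
Proof.
move=> aa ab; have [raa rab] : avoid1 (rev a) /\ avoid1 (rev b) by rewrite /avoid1 !all_rev.
apply: uniq_perm; rewrite ?(map_inj_uniq (can_inj revK)) ?quasi_shuffles_uniq// => s.
rewrite -{1}(revK s) (mem_map (can_inj revK)) !mem_quasi_shuffles//.
by rewrite mem_rev !restrict_rev !(can2_eq revK revK).
Qed.

Lemma avoid1_quasi_shuffle a b s : avoid1 a -> avoid1 b ->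
  s \in quasi_shuffles a b -> all (fun J : {set W} => None \notin J) s.
Proof.
move=> aa ab; rewrite mem_quasi_shuffles// => /and3P[_ /eqP sa _].
apply/allP => J Js; apply/negP => NJ; move/allP: aa => /(_ (inA A B @^-1: J)).
rewrite -sa mem_filter map_f// andbT.
have NpJ : None \in inA A B @^-1: J by rewrite inE.
rewrite NpJ andbF => H; have : inA A B @^-1: J != set0 by apply/set0Pn; exists None.
by move/H.
Qed.

End Restrict.

(** * Sequences with given restrictions *)

Section Fibres.
Context {A B : finType}.
Local Notation W := (option (A + B)).
Local Notation rA := (restrict_seq (inA A B)).
Local Notation rB := (restrict_seq (inB A B)).
Implicit Types (s : seq {set W}) (a : seq {set option A}) (b : seq {set option B}).

(** Both sides are cut at the first element satisfying [p]. *)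
Lemma cat_eq_mem (T : eqType) (p : pred T) (u u' v v' : seq T) (z z' : T) :
  ~~ has p u -> ~~ has p u' -> p z -> p z' ->
  u ++ z :: v = u' ++ z' :: v' -> [/\ u = u', z = z' & v = v'].
Proof.
elim: u u' => [|k u IHu] [|k' u'] //=.
- by move=> _ _ _ _ [-> ->].
- by move=> _ + pz _ [E]; rewrite -E pz.
- by move=> + _ _ pz' [E]; rewrite E pz'.
rewrite !negb_or => /andP[_ up] /andP[_ up'] pz pz' [-> E].
by have [-> -> ->] := IHu _ up up' pz pz' E.
Qed.

Section SplitFibre.
Variables (a0 a1 : seq {set option A}) (b0 b1 : seq {set option B}).
Variables (x : {set option A}) (y : {set option B}).
Hypotheses (aa0 : avoid1 a0) (aa1 : avoid1 a1) (ab0 : avoid1 b0) (ab1 : avoid1 b1).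
Hypotheses (Nx : None \in x) (Ny : None \in y).

Lemma restrict_glue s0 s1 :
  s0 \in quasi_shuffles a0 b0 -> s1 \in quasi_shuffles a1 b1 ->
  [/\ set0 \notin s0 ++ glue x y :: s1, rA (s0 ++ glue x y :: s1) = a0 ++ x :: a1 &
      rB (s0 ++ glue x y :: s1) = b0 ++ y :: b1].
Proof.
rewrite !mem_quasi_shuffles// => /and3P[s00 /eqP<- /eqP<-] /and3P[s10 /eqP<- /eqP<-].
have x0 : x != set0 by apply/set0Pn; exists None.
have y0 : y != set0 by apply/set0Pn; exists None.
rewrite mem_cat inE eq_sym glue_eq0 !negb_or s00 s10 (negPf x0).
rewrite !restrict_cat !restrict_cons preimA_glue ?preimB_glue ?Nx ?Ny//.
by rewrite (negPf x0) (negPf y0).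
Qed.

(** The block of 1 is forced to be [glue x y], and what precedes and what follows it are independent
    quasi-shuffles. *)
Lemma perm_fibre n :
  (forall s, proper_sequence s -> 0 < size s <= n)%N ->
  proper_sequence (a0 ++ x :: a1) -> proper_sequence (b0 ++ y :: b1) ->
  perm_eq [seq s <- seqs n | [&& set0 \notin s, rA s == a0 ++ x :: a1 & rB s == b0 ++ y :: b1]]
    [seq s0 ++ glue x y :: s1 | s0 <- quasi_shuffles a0 b0, s1 <- quasi_shuffles a1 b1].
Proof.
move=> szn pa pb.
have noN a b s : avoid1 a -> avoid1 b -> s \in quasi_shuffles a b ->
    ~~ has (fun J : {set W} => None \in J) s.
  by move=> aa ab sqs; rewrite -all_predC; exact: avoid1_quasi_shuffle sqs.
have NJ : None \in glue x y by rewrite in_glueN Nx.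
have avoidN (T : finType) (u : seq {set option T}) : avoid1 u ->
    ~~ has (fun J : {set option T} => None \in J) u.
  by rewrite -all_predC; apply: sub_all => J /andP[].
have restrictN (T : finType) (h : option T -> W) u : h None = None -> avoid1 u ->
    ~~ has (fun J : {set option T} => None \in J) (restrict_seq h u).
  move=> hN /avoidN/hasPn uN; apply/hasPn => J; rewrite mem_filter.
  by move=> /andP[_ /mapP[K Ku ->]]; rewrite inE hN uN.
apply: uniq_perm; first by rewrite filter_uniq ?seqs_uniq.
  apply: allpairs_uniq; rewrite ?quasi_shuffles_uniq//.
  move=> z z' /allpairsP[[u v] /= [uq vq ->]] /allpairsP[[u' v'] /= [uq' vq' ->]] E.
  by have [-> _ ->] := cat_eq_mem (noN _ _ _ aa0 ab0 uq) (noN _ _ _ aa0 ab0 uq') NJ NJ E.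
move=> s; rewrite mem_filter; apply/andP/allpairsP => [[/and3P[s0 /eqP sA /eqP sB] _]|].
  have : proper_sequence s by rewrite proper_restrict s0 sA sB pa.
  move=> /proper_split[u [J [v [E au av NJs]]]].
  move: s0 sA sB; rewrite E !restrict_cat !restrict_cons mem_cat inE !negb_or.
  (* Both traces of [J] contain 1, so neither is omitted and cutting at the block of 1 commutes with
     restriction. *)
  have NA : None \in inA A B @^-1: J by rewrite inE.
  have NB : None \in inB A B @^-1: J by rewrite inE.
  have /negPf -> : inA A B @^-1: J != set0 by apply/set0Pn; exists None.
  have /negPf -> : inB A B @^-1: J != set0 by apply/set0Pn; exists None.
  move=> /and3P[u0 _ v0].
  move=> /cat_eq_mem-/(_ _ (restrictN _ _ _ _ au) (avoidN _ _ aa0) NA Nx)[//|uA xE vA].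
  move=> /cat_eq_mem-/(_ _ (restrictN _ _ _ _ au) (avoidN _ _ ab0) NB Ny)[//|uB yE vB].
  exists (u, v); rewrite /= !mem_quasi_shuffles// u0 v0 uA uB vA vB !eqxx.
  by split=> //; rewrite -xE -yE glue_preim.
move=> [[s0 s1] /= [s0q s1q ->]].
have [s00 sA sB] := restrict_glue s0q s1q.
rewrite s00 sA sB !eqxx; split=> //; rewrite mem_seqs szn//.
by rewrite proper_restrict s00 sA sB pa.
Qed.

End SplitFibre.

(** * Signed sums over the fibres of restriction *)

Section Factorization.
Context {R : realFieldType} {V : comNzRingType}.
Variable c : W -> R.
Hypothesis c0 : \sum_j c j = 0.
Local Notation cA := (induced_weight (inA A B) c).
Local Notation cB := (induced_weight (inB A B) c).

(** The coefficient of t_s in the generalized retarded function, set to 0 outside M(S'). *)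
Definition sign_in_M (T : finType) (w : T -> R) (s : seq {set T}) : V :=
  (-1) ^+ (size s).-1 * (in_M (opposite (positive_sets w)) s)%:R.

Lemma sum_fibre a b : proper_sequence a -> proper_sequence b ->
  \sum_(s <- seqs #|{: W}| | (rA s == a) && (rB s == b)) sign_in_M c s =
  sign_in_M cA a * sign_in_M cB b.
Proof.
move=> pa pb.
have [a0 [x [a1 [aE aa0 aa1 Nx]]]] := proper_split pa.
have [b0 [y [b1 [bE ab0 ab1 Ny]]]] := proper_split pb.
rewrite aE in pa *; rewrite bE in pb *.
(* Sequences with an empty block are improper and have coefficient 0. *)
transitivity (\sum_(s <- seqs #|{: W}| | [&& set0 \notin s, rA s == a0 ++ x :: a1 &
    rB s == b0 ++ y :: b1]) sign_in_M c s).
  rewrite [LHS]big_mkcond [RHS]big_mkcond; apply: eq_bigr => s _.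
  case: (boolP (set0 \notin s)) => //= s0; case: ifP => // _.
  by rewrite /sign_in_M /in_M /proper_sequence (negPf s0) mulr0.
rewrite -big_filter (perm_big _ (perm_fibre aa0 aa1 ab0 ab1 Nx Ny _ pa pb)) /=; last first.
  by move=> s; apply: (size_proper None).
rewrite big_allpairs_dep.
pose p (T : finType) (w : T -> R) u := pos_suffixes 0 [seq - weight w J | J <- rev u].
pose q (T : finType) (w : T -> R) u := pos_suffixes 0 [seq weight w J | J <- u].
(* The block of 1 is the one not counted by the exponent [(size s).-1], so sign and condition both
   factor into a part before 1 and a part after 1. *)
transitivity (\sum_(s0 <- quasi_shuffles a0 b0) \sum_(s1 <- quasi_shuffles a1 b1)
    ((-1) ^+ size s0 * (p _ c s0)%:R) * ((-1) ^+ size s1 * (q _ c s1)%:R) : V).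
  rewrite big_seq [RHS]big_seq; apply: eq_bigr => s0 s0q.
  rewrite big_seq [RHS]big_seq; apply: eq_bigr => s1 s1q.
  have [s00 sA sB] := restrict_glue aa0 aa1 ab0 ab1 Nx Ny s0q s1q.
  rewrite /sign_in_M in_M_cat// ?proper_restrict ?s00 ?sA ?sB ?pa//.
  rewrite size_cat /= addnS /= -mulnb natrM exprD /p /q; ring.
under eq_bigr do rewrite -mulr_sumr.
rewrite -mulr_suml /sign_in_M !in_M_cat ?sum_induced_weight//.
rewrite !size_cat /= !addnS /= -!mulnb !natrM !exprD.
have sgnC (X : {set option A}) (Y : {set option B}) : None \notin X -> None \notin Y ->
    weight c (glue X Y) = weight cA X + weight cB Y.
  by move=> /negPf NX /negPf NY; rewrite weight_glue ?NX.
have -> : \sum_(s1 <- quasi_shuffles a1 b1) (-1) ^+ size s1 * (q _ c s1)%:R =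
    (-1) ^+ (size a1 + size b1) * (q _ cA a1 && q _ cB b1)%:R :> V.
  by apply: signed_sumE => //; rewrite weight0.
have -> : \sum_(s0 <- quasi_shuffles a0 b0) (-1) ^+ size s0 * (p _ c s0)%:R =
    (-1) ^+ (size a0 + size b0) * (p _ cA a0 && p _ cB b0)%:R :> V.
  (* The part before 1 is the count for the reversed lists and negated weights. *)
  rewrite -(size_rev a0) -(size_rev b0) /p.
  rewrite -(@signed_sumE _ _ _ _ (fun J => - weight c J) (fun J => - weight cA J)
    (fun J => - weight cB J)) /avoid1 ?all_rev ?weight0 ?oppr0//; last first.
    by move=> X Y NX NY; rewrite sgnC// opprD.
  rewrite /signed_sum -(perm_big _ (perm_rev_quasi_shuffles aa0 ab0)) big_map.
  by apply: eq_bigr => s _; rewrite size_rev.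
by rewrite !exprD -!mulnb !natrM /p /q; ring.
Qed.

Lemma big_sign_in_M_restrict (F : seq {set option A} -> seq {set option B} -> V) :
  \sum_(s <- seqs #|{: W}|) sign_in_M c s * F (rA s) (rB s) =
  \sum_(a <- seqs #|{: option A}|) \sum_(b <- seqs #|{: option B}|)
    sign_in_M cA a * sign_in_M cB b * F a b.
Proof.
have improper (T : finType) (w : T -> R) u : ~~ proper_sequence u -> sign_in_M w u = 0.
  by move=> /negPf pu; rewrite /sign_in_M /in_M pu mulr0.
have fibre a b : sign_in_M cA a * sign_in_M cB b =
    \sum_(s <- seqs #|{: W}| | (rA s == a) && (rB s == b)) sign_in_M c s.
  case: (boolP (proper_sequence a && proper_sequence b)) => [/andP[pa pb]|].
    by rewrite sum_fibre.
  rewrite negb_and => pab; rewrite big1 => [|s /andP[/eqP sA /eqP sB]].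
    by case/orP: pab => /improper ->; rewrite ?mul0r ?mulr0.
  rewrite improper// proper_restrict sA sB; apply: contraL pab.
  by case/and3P=> _ -> ->.
have pick (T : eqType) (L : seq T) (z : T) (G : T -> V) : uniq L -> z \in L ->
    \sum_(i <- L) (z == i)%:R * G i = G z.
  move=> uL zL; rewrite (bigD1_seq z)//= eqxx mul1r big1 ?addr0// => i /negPf iz.
  by rewrite eq_sym iz mul0r.
(* Insert indicators of the two restrictions. For proper [s] these restrictions are proper, so they
   occur in the lists summed over; the other [s] contribute 0. *)
transitivity (\sum_(s <- seqs #|{: W}|) \sum_(a <- seqs #|{: option A}|)
    (rA s == a)%:R * \sum_(b <- seqs #|{: option B}|)
    (rB s == b)%:R * (sign_in_M c s * F a b)).
  apply: eq_bigr => s _; case: (boolP (proper_sequence s)) => [|/improper->].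
    rewrite proper_restrict => /and3P[_ pA pB].
    rewrite pick ?seqs_uniq ?mem_seqs ?(size_proper None)//.
    by rewrite pick ?seqs_uniq ?mem_seqs ?(size_proper None).
  rewrite mul0r big1// => a _; rewrite big1 ?mulr0// => b _.
  by rewrite mul0r mulr0.
rewrite exchange_big; apply: eq_bigr => a _ /=.
under eq_bigr do rewrite mulr_sumr.
rewrite exchange_big; apply: eq_bigr => b _ /=.
rewrite fibre mulr_suml [RHS]big_mkcond; apply: eq_bigr => s _ /=.
by case: (_ == a); case: (_ == b); rewrite /= ?mul1r ?mul0r.
Qed.

End Factorization.

Lemma in_M_setT (T : finType) (S : {set {set option T}}) : in_M S [:: setT].
Proof.
rewrite /in_M /proper_sequence /= big_seq1 eqxx inE andbT; apply/andP; split.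
  by apply/eqP => /setP/(_ None); rewrite !inE.
by apply/forallP => -[[]].
Qed.

(** Were there no such [s], the sum over the fibre would vanish, whereas it is a product of two
    signs. *)
Lemma exists_common_refinement (R : realFieldType) (c : W -> R) a b :
  \sum_j c j = 0 ->
  in_M (opposite (positive_sets (induced_weight (inA A B) c))) a ->
  in_M (opposite (positive_sets (induced_weight (inB A B) c))) b ->
  exists s, [/\ proper_sequence s, rA s = a & rB s = b].
Proof.
move=> c0 aM bM; have pa : proper_sequence a by case/andP: aM.
have pb : proper_sequence b by case/andP: bM.
case: (boolP (has (fun s => [&& proper_sequence s, rA s == a & rB s == b])
                  (seqs #|{: W}|))).
  by move=> /hasP[s _ /and3P[ps /eqP sA /eqP sB]]; exists s.
move=> /hasPn noS; have /esym/eqP := sum_fibre (V := R) c0 pa pb.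
rewrite big_seq_cond big1 => [|s /and3P[/noS + sA sB]]; last first.
  by rewrite sA sB !andbT /sign_in_M /in_M => /negPf ->; rewrite mulr0.
by rewrite /sign_in_M aM bM !mulr1 -exprD signr_eq0.
Qed.

End Fibres.

From mathcomp Require Import all_classical all_reals all_analysis.
From mathcomp Require Import measurable_realfun.
Import numFieldNormedType.Exports.
Local Open Scope classical_set_scope.
Local Open Scope ring_scope.

(** * Smooth functions and integrals *)

Section SmoothOn.
Context {R : realType} {m n : nat}.
Implicit Types (U : set 'M[R]_(m, n)) (f g : 'M[R]_(m, n) -> R).

(** A coinduction principle. As [U] is open, closure of [K] under partial derivatives is needed only
    up to equality on [U]. *)
Lemma smooth_on_coind U (K : set ('M[R]_(m, n) -> R)) : open U ->
  (forall f, K f -> forall u, U u -> {for u, continuous f} /\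
     forall p : 'I_m * 'I_n, derivable f u (delta_mx p.1 p.2)) ->
  (forall f p, K f -> exists2 g, K g & {in U, partial p f =1 g}) ->
  forall f, K f -> smooth_on U f.
Proof.
move=> oU K0 KS f Kf s.
have near_eq g h u : {in U, g =1 h} -> U u -> \forall v \near u, g v = h v.
  move=> gh Uu; apply: filterS (open_nbhs_nbhs (conj oU Uu)) => v Uv.
  by apply: gh; rewrite inE.
have [g Kg fg] : exists2 g, K g & {in U, iter_partial s f =1 g}.
  elim: s => [|p s [g Kg fg]] /=; first by exists f.
  have [h Kh gh] := KS g p Kg; exists h => // u uU.
  by rewrite -gh//; apply: near_eq_derive; apply: near_eq fg _; exact: set_mem.
move=> u Uu; have [gc gd] := K0 _ Kg u Uu.
have gf : {in U, g =1 iter_partial s f} by move=> v /fg.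
split=> [|p]; last exact: near_eq_derivable (near_eq _ _ _ gf Uu) (gd p).
rewrite /prop_for /continuous_at fg ?inE//.
exact: cvg_trans (near_eq_cvg (near_eq _ _ u gf Uu)) gc.
Qed.

(** By the product rule this ring is closed under partial derivatives up to equality on [U]; no
    Leibniz formula for iterated derivatives is needed. *)
Inductive smooth_ring U : set ('M[R]_(m, n) -> R) :=
| SmoothRing_gen f : smooth_on U f -> smooth_ring U f
| SmoothRing_cst k : smooth_ring U (cst k)
| SmoothRing_add f g : smooth_ring U f -> smooth_ring U g -> smooth_ring U (f + g)
| SmoothRing_mul f g : smooth_ring U f -> smooth_ring U g -> smooth_ring U (f * g).

Lemma smooth_ring_derivable U f : smooth_ring U f -> forall u, U u ->
  {for u, continuous f} /\ forall p : 'I_m * 'I_n, derivable f u (delta_mx p.1 p.2).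
Proof.
elim=> {f} [f sf|k|f g _ IHf _ IHg|f g _ IHf _ IHg] u Uu.
- exact: (sf [::] u Uu).
- by split; [exact: cst_continuous|move=> p; exact: derivable_cst].
- have [fc fd] := IHf u Uu; have [gc gd] := IHg u Uu.
  by split=> [|p]; [exact: continuousD|exact: derivableD].
have [fc fd] := IHf u Uu; have [gc gd] := IHg u Uu.
by split=> [|p]; [exact: continuousM|exact: derivableM].
Qed.

Lemma smooth_ring_smooth U f : open U -> smooth_ring U f -> smooth_on U f.
Proof.
move=> oU; apply: smooth_on_coind => // {f}; first exact: smooth_ring_derivable.
move=> f p; elim=> {f} [f sf|k|f g Kf [f' Kf' ff'] Kg [g' Kg' gg']|f g Kf [f' Kf' ff'] Kg [g' Kg' gg']].
(* [iter_partial] is a right fold, so the last entry of [rcons s p] is differentiated first. *)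
- exists (partial p f) => //; apply: SmoothRing_gen => s u Uu.
  by have := sf (rcons s p) u Uu; rewrite /iter_partial foldr_rcons.
- exists (cst 0); first exact: SmoothRing_cst.
  by move=> u _; rewrite /partial derive_cst.
- exists (f' + g'); first exact: SmoothRing_add.
  move=> u uU; have Uu := set_mem uU; rewrite /partial deriveD.
  + by rewrite -[X in X + _]/(partial p f u) -[X in _ + X]/(partial p g u) ff'// gg'.
  + exact: (smooth_ring_derivable Kf Uu).2.
  + exact: (smooth_ring_derivable Kg Uu).2.
exists (f * g' + g * f').
  by apply: SmoothRing_add; exact: SmoothRing_mul.
move=> u uU; have Uu := set_mem uU; rewrite /partial deriveM.
+ by rewrite -[X in _ *: X + _]/(partial p g u) -[X in _ + _ *: X]/(partial p f u) ff'// gg'.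
+ exact: (smooth_ring_derivable Kf Uu).2.
+ exact: (smooth_ring_derivable Kg Uu).2.
Qed.

End SmoothOn.

(** * Smooth functions and test functions on the manifold *)

Section Functions.
Context {R : realType} {M : manifold R}.
Local Notation C := R[i].
Local Notation Re := (@complex.Re R).
Local Notation Im := (@complex.Im R).
Implicit Types (f g psi : M -> C).

Lemma ReD (x y : C) : Re (x + y) = Re x + Re y. Proof. by case: x y => [? ?] []. Qed.
Lemma ImD (x y : C) : Im (x + y) = Im x + Im y. Proof. by case: x y => [? ?] []. Qed.
Lemma ReM (x y : C) : Re (x * y) = Re x * Re y - Im x * Im y.
Proof. by case: x y => [? ?] []. Qed.
Lemma ImM (x y : C) : Im (x * y) = Re x * Im y + Im x * Re y.
Proof. by case: x y => [? ?] []. Qed.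

Lemma smooth_cst (k : C) : smooth (fun _ : M => k).
Proof. by move=> c _; split; apply: (smooth_ring_smooth (@cim_open _ _ _ c)); exact: SmoothRing_cst. Qed.

Lemma smoothD f g : smooth f -> smooth g -> smooth (fun x => f x + g x).
Proof.
move=> sf sg c Mc; have [fR fI] := sf c Mc; have [gR gI] := sg c Mc.
split; apply: (smooth_ring_smooth (@cim_open _ _ _ c)).
  rewrite (_ : _ \o _ = (Re \o f \o cfrom c) + (Re \o g \o cfrom c)).
    by apply: SmoothRing_add; exact: SmoothRing_gen.
  by apply/funext => u; rewrite [LHS]ReD.
rewrite (_ : _ \o _ = (Im \o f \o cfrom c) + (Im \o g \o cfrom c)).
  by apply: SmoothRing_add; exact: SmoothRing_gen.
by apply/funext => u; rewrite [LHS]ImD.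
Qed.

Lemma smoothM f g : smooth f -> smooth g -> smooth (fun x => f x * g x).
Proof.
move=> sf sg c Mc; have [fR fI] := sf c Mc; have [gR gI] := sg c Mc.
split; apply: (smooth_ring_smooth (@cim_open _ _ _ c)).
  rewrite (_ : _ \o _ = (Re \o f \o cfrom c) * (Re \o g \o cfrom c) +
      cst (-1) * ((Im \o f \o cfrom c) * (Im \o g \o cfrom c))).
    apply: SmoothRing_add; do ?apply: SmoothRing_mul;
      first [exact: SmoothRing_cst|exact: SmoothRing_gen].
  by apply/funext => u; rewrite [LHS]ReM -[in LHS]mulN1r.
rewrite (_ : _ \o _ = (Re \o f \o cfrom c) * (Im \o g \o cfrom c) +
    (Im \o f \o cfrom c) * (Re \o g \o cfrom c)).
  by apply: SmoothRing_add; apply: SmoothRing_mul; exact: SmoothRing_gen.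
by apply/funext => u; rewrite [LHS]ImM.
Qed.

Lemma smooth_sum (I : Type) (r : seq I) (F : I -> M -> C) :
  (forall i, smooth (F i)) -> smooth (fun x => \sum_(i <- r) F i x).
Proof.
move=> sF; elim: r => [|i r IHr].
  by under eq_fun do rewrite big_nil; exact: smooth_cst.
by under eq_fun do rewrite big_cons; exact: smoothD.
Qed.

Lemma continuous_chart (c : chart R M (Defs.dim M)) (h : M -> R) (x : M) :
  cdom c x -> {for cto c x, continuous (h \o cfrom c)} -> {for x, continuous h}.
Proof.
move=> cx hc.
have cc : {for x, continuous (cto c)}.
  have := @cto_continuous _ _ _ c; rewrite continuous_open_subspace; last exact: cdom_open.
  by apply; rewrite inE.
have hx : \forall y \near x, (h \o cfrom c \o cto c) y = h y.
  apply: filterS (open_nbhs_nbhs (conj (@cdom_open _ _ _ c) cx)) => y cy /=.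
  by rewrite ctoK.
have := continuous_comp cc hc; rewrite /prop_for /continuous_at /= ctoK// => hcc.
exact: cvg_trans (near_eq_cvg hx) hcc.
Qed.

Lemma smooth_continuous f : smooth f -> continuous (Re \o f) /\ continuous (Im \o f).
Proof.
move=> sf; split=> x; have [c Mc cx] := atlas_cover x; have [fR fI] := sf c Mc;
  apply: (continuous_chart cx).
- exact: (fR [::] _ (cto_im cx)).1.
- exact: (fI [::] _ (cto_im cx)).1.
Qed.

Lemma supp_mulr f psi : supp (fun x => f x * psi x) `<=` supp psi.
Proof.
by apply: closure_subset => x /=; apply: contra_neq => ->; rewrite mulr0.
Qed.

Lemma test_funM f psi : smooth f -> test_fun psi -> test_fun (fun x => f x * psi x).
Proof.
move=> sf [sp cp]; split; first exact: smoothM.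
by apply: subclosed_compact cp (@supp_mulr f psi); exact: closed_closure.
Qed.

Section Integral.
Variable mu : {measure set (borel M) -> \bar R}.
Hypothesis mu_density : smooth_positive_density mu.

(** On the compact set [K], which is closed and hence Borel, the measure is finite and [h] is
    bounded. *)
Lemma integrable_compact (h : M -> R) (K : set M) : continuous h -> compact K ->
  (forall x, ~ K x -> h x = 0) -> mu.-integrable setT (EFin \o (h : borel M -> R)).
Proof.
move=> hc Kc h0.
have mo (U : set M) : open U -> measurable (U : set (borel M)).
  by move=> oU; exact: sub_sigma_algebra.
have mK : measurable (K : set (borel M)).
  rewrite -(setCK K); apply: measurableC; apply: mo.
  by apply: closed_openC; exact: compact_closed (@carrier_hausdorff _ M) Kc.
rewrite (_ : EFin \o _ = (EFin \o h) \_ K); last first.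
  by apply/funext => x; rewrite patchE; case: ifPn => // /negP; rewrite inE => /h0 /= ->.
apply/(integrable_mkcond _ mK); apply: measurable_bounded_integrable => //.
- exact: mu_density.1.
- apply: measurable_funTS; apply: (measurability _ (RGenOpens.measurableE R)).
  move=> _ [_ [a [b ->] <-]]; rewrite setTI; apply: mo.
  by move/continuousP : hc; apply; exact: interval_open.
have hK : compact (h @` K).
  by apply: continuous_compact => //; exact: continuous_subspaceT.
have [N [Nr HN]] := compact_bounded hK.
by exists N; split=> // y Ny x Kx; apply: HN => //; exists x.
Qed.

Lemma test_fun_integrable (h : M -> C) : test_fun h ->
  mu.-integrable setT (EFin \o (Re \o h : borel M -> R)) /\
  mu.-integrable setT (EFin \o (Im \o h : borel M -> R)).
Proof.
move=> [sh ch]; have [hR hI] := smooth_continuous sh.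
have h0 x : ~ supp h x -> h x = 0.
  by apply: contra_notP => /eqP hx; exact: subset_closure.
by split; apply: (integrable_compact _ ch) => // x /h0 /= ->.
Qed.

Lemma cintegralD (h k : M -> C) : test_fun h -> test_fun k ->
  cintegral mu (fun y => h y + k y) = cintegral mu h + cintegral mu k.
Proof.
move=> /test_fun_integrable[hR hI] /test_fun_integrable[kR kI].
rewrite /cintegral [RHS]/GRing.add/=; congr Complex; rewrite -RintegralD//;
  by congr (Rintegral _ _ _); apply/funext => y; rewrite /= (ReD, ImD).
Qed.

Lemma test_fun0 : test_fun (fun _ : M => 0 : C).
Proof.
split; first exact: smooth_cst.
rewrite (_ : supp _ = set0); first exact: compact0.
rewrite /supp (_ : [set _ | _] = set0) ?closure0//.
by apply/seteqP; split=> x //=; rewrite eqxx.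
Qed.

Lemma cintegral0 : cintegral mu (fun _ : M => 0) = 0.
Proof.
by rewrite /cintegral; congr Complex; rewrite /Rintegral integral0_eq.
Qed.

Lemma test_funZ (k : C) (h : M -> C) : test_fun h -> test_fun (fun y => k * h y).
Proof. by apply: test_funM; exact: smooth_cst. Qed.

Lemma test_funD (h k : M -> C) : test_fun h -> test_fun k ->
  test_fun (fun y => h y + k y).
Proof.
move=> [sh ch] [sk ck]; split; first exact: smoothD.
apply: (subclosed_compact _ (compactU ch ck)); first exact: closed_closure.
rewrite /supp -closureU; apply: closure_subset => x /=.
case: (eqVneq (h x) 0) => [->|hx _]; last by left.
by rewrite add0r; right.
Qed.

Lemma cintegralZ (k : C) (h : M -> C) : test_fun h ->
  cintegral mu (fun y => k * h y) = k * cintegral mu h.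
Proof.
move=> /test_fun_integrable[hR hI].
have intZ (r : R) (u : borel M -> R) : mu.-integrable setT (EFin \o u) ->
    mu.-integrable setT (EFin \o (fun y => r * u y)).
  move=> iu; rewrite (_ : _ \o _ = (fun y => r%:E * (EFin \o u) y)%E).
    exact: integrableZl.
  by apply/funext => y /=; rewrite EFinM.
rewrite /cintegral; case: k => a b; rewrite [RHS]/GRing.mul/=.
rewrite -!RintegralZl// -RintegralB// -?RintegralD//; do ?exact: intZ.
by congr Complex; congr (Rintegral _ _ _); apply/funext => y; rewrite /= (ReM, ImM).
Qed.

Lemma test_fun_sum (I : Type) (r : seq I) (k : I -> C) (H : I -> M -> C) :
  (forall i, test_fun (H i)) -> test_fun (fun y => \sum_(i <- r) k i * H i y).
Proof.
move=> tH; elim: r => [|i r IHr].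
  by under eq_fun do rewrite big_nil; exact: test_fun0.
by under eq_fun do rewrite big_cons; apply: test_funD => //; exact: test_funZ.
Qed.

Lemma cintegral_sum (I : Type) (r : seq I) (k : I -> C) (H : I -> M -> C) :
  (forall i, test_fun (H i)) ->
  cintegral mu (fun y => \sum_(i <- r) k i * H i y) =
  \sum_(i <- r) k i * cintegral mu (H i).
Proof.
move=> tH; elim: r => [|i r IHr].
  by under eq_fun do rewrite big_nil; rewrite big_nil cintegral0.
under eq_fun do rewrite big_cons.
by rewrite big_cons cintegralD ?cintegralZ ?IHr//; [exact: test_funZ|exact: test_fun_sum].
Qed.

End Integral.
End Functions.

(** * Smeared retarded functions and their products *)

Section Products.
Context {R : realType} {M : manifold R}.
Local Notation C := R[i].
Variable mu : {measure set (borel M) -> \bar R}.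
Hypothesis mu_density : smooth_positive_density mu.

Lemma generalized_retardedE (W : finType) (t : seq {set W} -> ({ptws W -> M} -> C) -> C)
    (w : W -> R) f :
  generalized_retarded t (positive_sets w) f =
  \sum_(s <- seqs #|{: W}|) sign_in_M w s * t s f.
Proof.
rewrite [LHS](big_seqs _ (in_M _) (fun s => t s f)) big_mkcond; apply: eq_bigr => s _.
by rewrite /sign_in_M; case: (in_M _ _); rewrite /= ?mulr1// mulr0 mul0r.
Qed.

(* Smeared functions enter a product only through integrals against test
   functions, so any two smeared functions of the same distribution may be
   exchanged without knowing that they coincide. *)
Lemma product_smearing (K1 W1 K2 W2 : finType) (h1 : K1 -> W1) (k1 : W1)
    (h2 : K2 -> W2) (k2 : W2) F1 F2 phi1 phi2 (f1 g1 f2 g2 psi : M -> C) :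
  smearing mu h1 k1 F1 phi1 f1 -> smearing mu h1 k1 F1 phi1 g1 ->
  smearing mu h2 k2 F2 phi2 f2 -> smearing mu h2 k2 F2 phi2 g2 -> test_fun psi ->
  cintegral mu (fun y => f1 y * f2 y * psi y) =
  cintegral mu (fun y => g1 y * g2 y * psi y).
Proof.
move=> [sf1 Ff1] [sg1 Fg1] [sf2 Ff2] [sg2 Fg2] tpsi.
transitivity (cintegral mu (fun y => f1 y * (f2 y * psi y))).
  by congr cintegral; apply/funext => y; rewrite mulrA.
rewrite -(Ff1 (fun y => f2 y * psi y)) ?(Fg1 (fun y => f2 y * psi y)); try exact: test_funM.
transitivity (cintegral mu (fun y => f2 y * (g1 y * psi y))).
  by congr cintegral; apply/funext => y; rewrite mulrCA.
rewrite -(Ff2 (fun y => g1 y * psi y)) ?(Fg2 (fun y => g1 y * psi y)); try exact: test_funM.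
by congr cintegral; apply/funext => y; rewrite mulrCA mulrA.
Qed.

(** One function per index, smooth even where no smeared function exists (the default is 0), so that
    sums over all sequences remain smooth. *)
Lemma smearing_choice (T : Type) (K W : finType) (h : K -> W) (k : W)
    (F : T -> ({ptws W -> M} -> C) -> C) phi :
  exists G : T -> M -> C, (forall i, smooth (G i)) /\
    forall i g, smearing mu h k (F i) phi g -> smearing mu h k (F i) phi (G i).
Proof.
have /choice[G GP] i : exists g, smooth g /\
    ((exists g', smearing mu h k (F i) phi g') -> smearing mu h k (F i) phi g).
  have [[g Fg]|noF] := pselect (exists g, smearing mu h k (F i) phi g).
    by exists g; split=> //; case: Fg.
  by exists (fun=> 0); split; [exact: smooth_cst|move=> /noF].
exists G; split=> [i|i g Fg]; first exact: (GP i).1.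
by apply: (GP i).2; exists g.
Qed.

(** Smearing is linear, and only sequences in M(S') have non-zero coefficients, so [G] has to be
    correct only there. *)
Lemma smearing_retarded (K W : finType) (h : K -> W) (k : W)
    (t : seq {set W} -> ({ptws W -> M} -> C) -> C) (w : W -> R) phi
    (G : seq {set W} -> M -> C) : (forall s, smooth (G s)) ->
  (forall s, in_M (opposite (positive_sets w)) s -> smearing mu h k (t s) phi (G s)) ->
  smearing mu h k (generalized_retarded t (positive_sets w)) phi
    (fun y => \sum_(s <- seqs #|{: W}|) sign_in_M w s * G s y).
Proof.
move=> sG tG; split.
  by apply: smooth_sum => s; apply: smoothM => //; exact: smooth_cst.
move=> psi tpsi; rewrite generalized_retardedE.
transitivity (cintegral mu (fun y => \sum_(s <- seqs #|{: W}|)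
    sign_in_M w s * (G s y * psi y))); last first.
  congr cintegral; apply/funext => y; rewrite mulr_suml.
  by apply: eq_bigr => s _; rewrite mulrA.
rewrite cintegral_sum// => [|s]; last exact: test_funM.
apply: eq_bigr => s _; case: (boolP (in_M (opposite (positive_sets w)) s)) => sM.
  by rewrite (tG s sM).2.
by rewrite /sign_in_M (negPf sM) mulr0 !mul0r.
Qed.
End Products.

Theorem corollary3p1 (R : realType) (M : manifold R)
  (le : M -> M -> Prop)
  (le_closed : closed [set p : M * M | le p.1 p.2]%classic)
  (le_refl : forall x, le x x)
  (mu : {measure set (borel M) -> \bar R})
  (mu_density : smooth_positive_density mu)
  (A B : finType) (A_gt0 : (0 < #|A|)%N) (B_gt0 : (0 < #|B|)%N)
  (t : seq {set option (A + B)} ->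
       ({ptws option (A + B) -> M} -> R[i]) -> R[i])
  (t1 : seq {set option A} -> ({ptws option A -> M} -> R[i]) -> R[i])
  (t2 : seq {set option B} -> ({ptws option B -> M} -> R[i]) -> R[i])
  (gtof_t : gtof mu le t) (gtof_t1 : gtof mu le t1) (gtof_t2 : gtof mu le t2)
  (t_product : forall s, proper_sequence s ->
     is_product mu (t s) (t1 (restrict_seq (inA A B) s))
                         (t2 (restrict_seq (inB A B) s)))
  (S : {set {set option (A + B)}}) (cell_S : cell R S) :
  is_product mu (generalized_retarded t S)
    (generalized_retarded t1 (induced_cell (inA A B) S))
    (generalized_retarded t2 (induced_cell (inB A B) S)).
Proof.
have [c c0 ->] := cellE cell_S.
rewrite !induced_cell_positive//; try exact: inA_inj; try exact: inB_inj.
set cA := induced_weight _ c; set cB := induced_weight _ c.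
move=> phiA phiB tA tB.
(* The functions given by [t_product] depend on [s]. Fixing one for each [a] and each [b] makes
   every term depend on [s] only through its restrictions and its coefficient. *)
have [G1 [sG1 G1P]] := smearing_choice mu Some None t1 phiA.
have [G2 [sG2 G2P]] := smearing_choice mu Some None t2 phiB.
exists (fun y => \sum_(a <- seqs #|{: option A}|) sign_in_M cA a * G1 a y).
exists (fun y => \sum_(b <- seqs #|{: option B}|) sign_in_M cB b * G2 b y).
split.
- apply: smearing_retarded => // a aM.
  (* Pairing [a] with the one-block sequence, which has no proper partial union, exhibits [a] as the
     restriction of a proper sequence, to which [t_product] applies. *)
  have [s [ps <- _]] := exists_common_refinement c0 aM (in_M_setT _).
  by have [g1 [g2 [Fg1 _ _]]] := t_product s ps phiA phiB tA tB; exact: G1P Fg1.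
- apply: smearing_retarded => // b bM.
  have [s [ps _ <-]] := exists_common_refinement c0 (in_M_setT _) bM.
  by have [g1 [g2 [_ Fg2 _]]] := t_product s ps phiA phiB tA tB; exact: G2P Fg2.
move=> psi tpsi; rewrite generalized_retardedE.
pose I a b := cintegral mu (fun y => G1 a y * G2 b y * psi y).
have tG a b : test_fun (fun y => G1 a y * G2 b y * psi y).
  by apply: test_funM => //; exact: smoothM.
transitivity (\sum_(s <- seqs #|{: option (A + B)}|) sign_in_M c s *
    I (restrict_seq (inA A B) s) (restrict_seq (inB A B) s)).
  apply: eq_bigr => s _; case: (boolP (proper_sequence s)) => ps; last first.
    by rewrite /sign_in_M /in_M (negPf ps) mulr0 !mul0r.
  have [g1 [g2 [Fg1 Fg2 ->//]]] := t_product s ps phiA phiB tA tB.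
  (* Exchange the functions attached to [s] for the fixed ones under the integral. *)
  by congr (_ * _); apply: product_smearing Fg1 (G1P _ _ Fg1) Fg2 (G2P _ _ Fg2) tpsi.
rewrite big_sign_in_M_restrict//.
(* The double sum now factors over a and b; move it inside the integral. *)
transitivity (cintegral mu (fun y => \sum_(a <- seqs #|{: option A}|) sign_in_M cA a *
    \sum_(b <- seqs #|{: option B}|) sign_in_M cB b * (G1 a y * G2 b y * psi y))).
  rewrite cintegral_sum//; last by move=> a; exact: test_fun_sum.
  apply: eq_bigr => a _; rewrite cintegral_sum// mulr_sumr.
  by apply: eq_bigr => b _; rewrite mulrA.
congr cintegral; apply/funext => y; rewrite !mulr_suml; apply: eq_bigr => a _.
rewrite mulr_sumr [in RHS]mulr_sumr mulr_suml; apply: eq_bigr => b _.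
by ring.
Qed.
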